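(* The following equalities of sets of one-sided infinite binary words hold: $$G_{01}=01\bullet W,$$ $$G_{001}=0\,\delta\big((01)^{-1}G_{01}\cup G_{001}\big),$$ $$G_{0001}=\delta(G_{1}),$$ $$G_{1}=0^{-1}G_{01}.$$
   Context: A factor of a word is a finite contiguous subword. A word $w$ encounters a pattern $p\in\{0,1\}^*$ if $g(p)$ is a factor of $w$ for some non-erasing morphism $g:\{0,1\}^*\to\{0,1\}^*$ (i.e. $g(0),g(1)$ non-empty). A (finite or one-sided infinite) binary word is good if it contains neither $11$ nor $1001$ as a factor, and encounters neither of the patterns $0000$ and $00010100$. Let $\delta$ be the morphism with $\delta(0)=01$, $\delta(1)=00$, extended to infinite words. $G$ is the set of one-sided infinite good words, and for $w\in\{0,1\}^*$, $G_w=G\cap w\{0,1\}^\omega$ is the set of those with prefix $w$. For a set $L$ of infinite words and a finite word $x$: $x^{-1}L=\{\mathbf{y}:x\mathbf{y}\in L\}$, $\delta(L)=\{\delta(\mathbf{y}):\mathbf{y}\in L\}$, and $xL=\{x\mathbf{y}:\mathbf{y}\in L\}$. Operators. Suppose a finite binary word $w$ has a suffix $\delta^n(01)$ for some $n\ge 0$; let $n$ be as large as possible and write $w=y\,\delta^n(01)$. Define $\alpha(w)=w\,\delta^n(00)=y\,\delta^{n+1}(01)$, $\beta(w)=w\,\delta^n(0100)=y\,\delta^{n+1}(001)$, $\gamma(w)=w\,\delta^n(010100)=y\,\delta^{n+1}(0001)$. Let $B=\{\alpha,\beta,\gamma\}$. For $\mathbf{f}=f_1f_2f_3\cdots\in B^\omega$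 and such a $w$, the word $w$ is a proper prefix of $f_1(w)$, which is a proper prefix of $f_2(f_1(w))$, and so on; $w\bullet\mathbf{f}$ denotes the one-sided infinite word having all of $f_n(f_{n-1}(\cdots f_1(w)\cdots))$, $n\ge1$, as prefixes. Let $W=\{\mathbf{f}\in B^\omega:01\bullet\mathbf{f}\in G\}$ and $01\bullet W=\{01\bullet\mathbf{f}:\mathbf{f}\in W\}$. *)

(* Defs.v *)
From mathcomp Require Import all_boot.
From mathcomp Require Import boolp classical_sets.

Set Implicit Arguments.
Unset Strict Implicit.
Unset Printing Implicit Defensive.

Local Open Scope classical_set_scope.

Notation "`0" := false (at level 0).
Notation "`1" := true (at level 0).

Definition word := seq bool.

Definition iword := nat -> bool.

Definition iprefix (x : word) (u : iword) : Prop := mkseq u (size x) = x.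

Definition ifactor (x : word) (u : iword) : Prop :=
  exists i, iprefix x (fun j => u (i + j)).

Definition icat (x : word) (y : iword) : iword :=
  fun i => if i < size x then nth `0 x i else y (i - size x).

(* A morphism of {0,1}^* is given by the images of the two letters. *)
Definition morph (g : bool -> word) (w : word) : word := flatten (map g w).

Definition nonerasing (g : bool -> word) : Prop := forall a, g a <> [::].

(* For a non-erasing g, the image of the prefix of length i + 1 has length at
   least i + 1, so the default letter of nth is never used. *)
Definition imorph (g : bool -> word) (u : iword) : iword :=
  fun i => nth `0 (morph g (mkseq u i.+1)) i.

Definition iencounters (p : word) (u : iword) : Prop :=
  exists g, nonerasing g /\ ifactor (morph g p) u.

Definition igood (u : iword) : Prop :=
  [/\ ~ ifactor [:: `1; `1] u,
      ~ ifactor [:: `1; `0; `0; `1] u,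
      ~ iencounters [:: `0; `0; `0; `0] u
    & ~ iencounters [:: `0; `0; `0; `1; `0; `1; `0; `0] u].

Definition G : set iword := [set u | igood u].

Definition Gp (w : word) : set iword := G `&` (icat w @` setT).

Definition delta_letter (a : bool) : word :=
  if a then [:: `0; `0] else [:: `0; `1].

Definition delta : word -> word := morph delta_letter.

Definition idelta : iword -> iword := imorph delta_letter.

(* The largest n such that delta^n(01) is a suffix of w.  The length of
   delta^n(01) is 2^(n+1), so every such n is smaller than size w.  The value
   is 0 when there is no such n; this never occurs for words obtained from 01
   by the operators below, which keep a suffix of this form. *)
Definition level (w : word) : nat :=
  \max_(n < size w | suffix (iter n delta [:: `0; `1]) w) n.

Inductive oper := Alpha | Beta | Gamma.

Definition oper_word (f : oper) : word :=
  match f with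
  | Alpha => [:: `0; `0]
  | Beta => [:: `0; `1; `0; `0]
  | Gamma => [:: `0; `1; `0; `1; `0; `0]
  end.

Definition apply_oper (f : oper) (w : word) : word :=
  w ++ iter (level w) delta (oper_word f).

(* The sequence f_1 f_2 ... is indexed from 0, so
   apply_opers w f n = f_n (... (f_1 w)). *)
Fixpoint apply_opers (w : word) (f : nat -> oper) (n : nat) : word :=
  if n is m.+1 then apply_oper (f m) (apply_opers w f m) else w.

(* Each operator strictly extends its argument, so apply_opers w f i.+1 has a
   letter at position i, and it is a prefix of all later terms. *)
Definition bullet (w : word) (f : nat -> oper) : iword :=
  fun i => nth `0 (apply_opers w f i.+1) i.

Definition W : set (nat -> oper) := [set f | G (bullet [:: `0; `1] f)].

(* Main.v *)
(* Gaps between consecutive 1s in a good word are 1 or 3 zeros, so a good word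
   whose 1s all sit at odd positions is delta(u), and delta(u) is good exactly
   when u is.  An occurrence of a pattern at the very start of a u can be
   conjugated into one inside delta(a u) with its first letter removed, which
   gives the left extensions.  Finally, each word of G_01 is delta(0^k v) with
   v in G_01 and k <= 2; the values of k are the letters alpha, beta, gamma.
   Along the iteration the prefix is y delta^n(01) with |y| < 2^(n+2), too
   short for the level to exceed n. *)
Require Import Defs.
From mathcomp Require Import all_boot.
From mathcomp Require Import boolp classical_sets.
From mathcomp Require Import zify.

Local Open Scope classical_set_scope.

(** * Shifts, prefixes and excluded factors of infinite words *)

Definition ishift (n : nat) (u : iword) : iword := fun j => u (n + j).

Lemma iprefixP (x : word) (u : iword) :
  iprefix x u <-> forall j, j < size x -> u j = nth `0 x j.
Proof.
split=> [<- j|H]; first by rewrite size_mkseq => jx; rewrite nth_mkseq.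
by apply: (@eq_from_nth _ `0) => [|j]; rewrite size_mkseq // => jx; rewrite nth_mkseq ?H.
Qed.

Lemma iprefix_cat (x y : word) (u : iword) :
  iprefix (x ++ y) u <-> iprefix x u /\ iprefix y (ishift (size x) u).
Proof.
rewrite !iprefixP size_cat; split=> [H|[Hx Hy] j jxy].
  split=> j jx; first by rewrite H ?nth_cat ?jx //; lia.
  by rewrite /ishift H ?nth_cat; [rewrite ifF ?addKn //; lia | lia].
rewrite nth_cat; case: ltnP => jx; first exact: Hx.
by rewrite -Hy /ishift ?subnKC //; lia.
Qed.

Lemma ishift_ishift (m n : nat) (u : iword) : ishift m (ishift n u) = ishift (n + m) u.
Proof. by apply/funext => j; rewrite /ishift addnA. Qed.

Lemma ishift_icat (x : word) (u : iword) : ishift (size x) (icat x u) = u.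
Proof.
by apply/funext => j; rewrite /ishift /icat ifF ?addKn //; lia.
Qed.

Lemma icat_ishift (x : word) (u : iword) :
  iprefix x u -> icat x (ishift (size x) u) = u.
Proof.
move/iprefixP => xu; apply/funext => j; rewrite /icat /ishift.
by case: ltnP => jx; [rewrite xu | rewrite subnKC].
Qed.

Lemma iprefix_icat (x : word) (u : iword) : iprefix x (icat x u).
Proof. by apply/iprefixP => j jx; rewrite /icat jx. Qed.

Lemma icat_cat (x y : word) (u : iword) : icat (x ++ y) u = icat x (icat y u).
Proof.
apply/funext => j; rewrite /icat size_cat nth_cat.
case: ltnP => jxy; case: ltnP => jx //; last by rewrite ifF; [congr (u _)|]; lia.
  by rewrite ifT //; lia.
by lia.
Qed.

Lemma GpE (w : word) (u : iword) : Gp w u <-> igood u /\ iprefix w u.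
Proof.
split=> [[Gu [v _ uE]]|[Gu wu]]; first by split=> //; rewrite -uE; exact: iprefix_icat.
by split=> //; exists (ishift (size w) u) => //; exact: icat_ishift.
Qed.

Lemma ifactor_ishift (x : word) (n : nat) (u : iword) :
  ifactor x (ishift n u) -> ifactor x u.
Proof.
case=> i; rewrite -/(ishift i _) ishift_ishift => xu; by exists (n + i).
Qed.

Lemma iencounters_ishift (p : word) (n : nat) (u : iword) :
  iencounters p (ishift n u) -> iencounters p u.
Proof. by case=> g [ng] /ifactor_ishift; exists g. Qed.

Lemma igood_ishift (n : nat) (u : iword) : igood u -> igood (ishift n u).
Proof.
by case=> ? ? ? ?; split=> [/ifactor_ishift|/ifactor_ishift|/iencounters_ishift|/iencounters_ishift].
Qed.

Lemma igood_no11 (u : iword) (i : nat) : igood u -> u i -> u i.+1 -> False.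
Proof.
case=> H _ _ _ ui ui1; apply: H; exists i; apply/iprefixP.
by case=> [|[|//]] _; rewrite ?addn0 ?addn1 /= ?ui ?ui1.
Qed.

Lemma igood_no1001 (u : iword) (i : nat) :
  igood u -> u i -> ~~ u i.+1 -> ~~ u i.+2 -> u i.+3 -> False.
Proof.
case=> _ H _ _ u0 /negbTE u1 /negbTE u2 u3; apply: H; exists i; apply/iprefixP.
by case=> [|[|[|[|//]]]] _; rewrite ?addn0 ?addn1 ?addn2 ?addn3 /=.
Qed.

Lemma igood_no0000 (u : iword) (i : nat) :
  igood u -> ~~ u i -> ~~ u i.+1 -> ~~ u i.+2 -> ~~ u i.+3 -> False.
Proof.
case=> _ _ H _ /negbTE u0 /negbTE u1 /negbTE u2 /negbTE u3; apply: H.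
exists (fun=> [:: `0]); split=> //; exists i; apply/iprefixP.
by case=> [|[|[|[|//]]]] _; rewrite ?addn0 ?addn1 ?addn2 ?addn3 /=.
Qed.

(** * The morphism [delta] on finite and infinite words *)

Lemma delta_cat (x y : word) : delta (x ++ y) = delta x ++ delta y.
Proof. by rewrite /delta /morph map_cat flatten_cat. Qed.

Lemma size_delta (x : word) : size (delta x) = (size x).*2.
Proof.
by elim: x => [|a x IH] //; rewrite -cat1s delta_cat !size_cat IH doubleD; case: a.
Qed.

(* The default letter 1 makes this hold also beyond the end of x. *)
Lemma nth_delta (x : word) (i : nat) :
  nth `0 (delta x) i = odd i && ~~ nth `1 x i./2.
Proof.
elim: x i => [|a x IH] i; first by rewrite !nth_nil andbF.
rewrite -cat1s delta_cat; case: i => [|[|i]]; [by case: a|by case: a|].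
by have := IH i; rewrite /= negbK; case: a.
Qed.

Lemma ideltaE (u : iword) (i : nat) : idelta u i = odd i && ~~ u i./2.
Proof.
by rewrite /idelta /imorph -/(delta _) nth_delta nth_mkseq //; lia.
Qed.

Lemma idelta_icat (x : word) (u : iword) :
  idelta (icat x u) = icat (delta x) (idelta u).
Proof.
apply/funext => i; rewrite ideltaE /icat size_delta nth_delta ideltaE.
case: ltnP => ix; first by rewrite ifT; [rewrite (set_nth_default `0)|lia].
rewrite ifF; last by lia.
by rewrite oddB ?odd_double ?addbF; [congr (_ && ~~ u _); lia|lia].
Qed.

Lemma iprefix_idelta (x : word) (u : iword) :
  iprefix x u -> iprefix (delta x) (idelta u).
Proof. by move=> /icat_ishift <-; rewrite idelta_icat; exact: iprefix_icat. Qed.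

Lemma ishift_idelta (n : nat) (u : iword) :
  ishift n.*2 (idelta u) = idelta (ishift n u).
Proof.
apply/funext => j; rewrite /ishift !ideltaE oddD odd_double /=.
by congr (_ && ~~ u _); lia.
Qed.

(** * Transfer of pattern occurrences between u and [idelta u] *)

Lemma delta_morph (g : bool -> word) (p : word) :
  delta (morph g p) = morph (delta \o g) p.
Proof. by elim: p => // a p IH; rewrite /morph /= -/(morph _ _) delta_cat IH. Qed.

Lemma iencounters_idelta (p : word) (u : iword) :
  iencounters p u -> iencounters p (idelta u).
Proof.
case=> g [ng [i]] /iprefix_idelta.
rewrite delta_morph -/(ishift i u) -ishift_idelta => H.
exists (delta \o g); split; last by exists i.*2.
by move=> a /= /(congr1 size); have := ng a; case: (g a) => //= b s _; rewrite size_delta.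
Qed.

(* Images under delta start with 0, so an occurrence of g(p) at the start of u
   yields one of the conjugated morphism 0^-1 (delta o g) 0 one position later. *)
Lemma iencounters_conj (p : word) (g : bool -> word) (u : iword) :
  nonerasing g -> iprefix (morph g p) u -> iencounters p (ishift 1 (idelta u)).
Proof.
move=> ng pu.
pose g' a := behead (delta (g a)) ++ [:: `0].
have g'E q : `0 :: morph g' q = delta (morph g q) ++ [:: `0].
  elim: q => // a q IH; rewrite /morph /= -!/(morph _ _) delta_cat -catA -IH.
  by rewrite /g'; have := ng a; case: (g a) => // -[] s _ /=; rewrite -catA.
exists g'; split; first by move=> a /(congr1 size); rewrite size_cat addnC.
exists 0; have: iprefix (`0 :: morph g' p) (idelta u).
  rewrite g'E; apply/iprefix_cat; split; first exact: iprefix_idelta.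
  by apply/iprefixP => -[|//] _; rewrite /ishift addn0 size_delta ideltaE odd_double.
by rewrite -cat1s => /iprefix_cat [].
Qed.

(* The letters at odd positions of an occurrence in idelta u, negated, spell a
   factor of u; b is the parity of the starting position.  Rounding the length
   up keeps the result nonempty. *)
Definition half (b : bool) (x : word) : word :=
  mkseq (fun k => ~~ nth `0 x (k.*2 + ~~ b)) (uphalf (size x)).

Lemma iprefix_half (u : iword) (x : word) (i : nat) : ~~ odd (size x) ->
  iprefix x (ishift i (idelta u)) -> iprefix (half (odd i) x) (ishift i./2 u).
Proof.
move=> ex /iprefixP H; apply/iprefixP => j; rewrite size_mkseq => jx.
rewrite nth_mkseq // -H; last by case: (odd i); lia.
rewrite /ishift ideltaE.
have -> : odd (i + (j.*2 + ~~ odd i)) by rewrite !oddD odd_double; case: (odd i).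
by rewrite /= negbK; congr (u _); have := odd_double_half i; case: (odd i); lia.
Qed.

(** Blocks of even length all start at the same parity, so one map [half (odd i)] serves every block
    and the halved blocks again form the image of p under a morphism. *)
Lemma iprefix_morph_half (u : iword) (g : bool -> word) (p : word) (i : nat) :
  {in p, forall a, ~~ odd (size (g a))} ->
  iprefix (morph g p) (ishift i (idelta u)) ->
  iprefix (morph (half (odd i) \o g) p) (ishift i./2 u).
Proof.
elim: p i => // a p IH i ev; rewrite /morph /= -!/(morph _ _).
have ea : ~~ odd (size (g a)) by apply: ev; rewrite inE eqxx.
case/iprefix_cat => Ha; rewrite ishift_ishift => Hp.
apply/iprefix_cat; split; first exact: iprefix_half.
have := IH _ _ Hp; rewrite ishift_ishift size_mkseq oddD (negbTE ea) addbF.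
have -> : (i + size (g a))./2 = i./2 + uphalf (size (g a)) by lia.
by apply=> b bp; apply: ev; rewrite inE bp orbT.
Qed.

Lemma iencounters_half (u : iword) (g : bool -> word) (p : word) (i : nat) :
  nonerasing g -> {in p, forall a, ~~ odd (size (g a))} ->
  iprefix (morph g p) (ishift i (idelta u)) -> iencounters p u.
Proof.
move=> ng ev /(iprefix_morph_half _ _ _ _ ev) H.
exists (half (odd i) \o g); split; last by exists i./2.
move=> a /(congr1 size) /=; rewrite size_mkseq.
by have := ng a; case: (g a).
Qed.

(** * Goodness under [idelta], and desubstitution *)

Lemma odd_occurrences (u : iword) (x : word) (i j : nat) : `1 \in x ->
  iprefix x (ishift i (idelta u)) -> iprefix x (ishift j (idelta u)) ->
  odd i = odd j.
Proof.
case/(nthP `0) => k kx kE /iprefixP Hi /iprefixP Hj.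
(* All 1s of [idelta u] sit at odd positions, so a single 1 of x fixes the parity of the start. *)
have := Hi _ kx; have := Hj _ kx; rewrite kE /ishift !ideltaE !oddD.
by move=> /andP[+ _] /andP[+ _]; case: (odd k); case: (odd i); case: (odd j).
Qed.

(** Two of four consecutive positions are odd, and zeros there come from two adjacent 1s of u. *)
Lemma idelta_no0000 (u : iword) (i : nat) : igood u ->
  ~~ idelta u i -> ~~ idelta u i.+1 -> ~~ idelta u i.+2 -> ~~ idelta u i.+3 -> False.
Proof.
move=> gu H0 H1 H2 H3.
have E k l : l = k.*2.+1 -> ~~ idelta u l -> u k.
  by move=> ->; rewrite ideltaE /= odd_double /= uphalf_double negbK.
apply: (igood_no11 _ i./2 gu); have := odd_double_half i; case: (odd i) => iE.
- by apply: E H0; lia.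
- by apply: E H1; lia.
- by apply: E H2; lia.
- by apply: E H3; lia.
Qed.

(* Gaps between consecutive 1s are 1 or 3 zeros, so if Y starts with i and ends
   with j zeros, then i + j is even, yet it is also a gap in YY. *)
Lemma igood_no1YY1 (u : iword) (m c : nat) : igood u -> 0 < c ->
  u m -> u (m + c.*2).+1 -> ~ (forall j, j < c -> u (m.+1 + j) = u (m.+1 + j + c)).
Proof.
move=> gu c0 um ue H.
have um1 : ~~ u m.+1 by apply/negP => /(igood_no11 _ _ gu um).
have ue1 : ~~ u (m + c.*2) by apply/negP => /(igood_no11 _ _ gu); apply.
have E k l : m < k -> k <= m + c -> l = k + c -> u l = u k.
  by move=> k1 k2 ->; have := H (k - m.+1); rewrite subnKC // => -> //; lia.
have umc : ~~ u (m + c) by rewrite -(E _ (m + c.*2)) //; lia.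
have umc1 : ~~ u (m + c).+1 by rewrite (E m.+1) //; lia.
(* Y of length 1 gives 1001 and Y of length 2 gives 0000. From length 3 on, the cases are whether Y
   ends in 10, in 100 or in 000. *)
case: c => // -[|[|c]] in c0 ue H E ue1 umc umc1 *.
- by apply: (igood_no1001 _ m gu); rewrite // -?(addn2 m) -?(addn1 m); move: umc1 ue; rewrite ?addn1 ?addn3 ?addn2.
- apply: (igood_no0000 _ m.+1 gu) => //.
  + by move: umc; rewrite addn2.
  + by move: umc1; rewrite addn2.
  + by move: ue1; rewrite addn4.
rewrite !addnS in umc umc1.
have [v1|v1] := boolP (u (m + c).+2).
  have v2 : ~~ u (m + c).+4.+1 by apply/negP; apply: (igood_no1001 _ _ gu v1).
  have m2 : ~~ u m.+2 by rewrite -(E _ (m + c).+4.+1) //; lia.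
  have [m3|m3] := boolP (u m.+3); first exact: (igood_no1001 _ m gu).
  apply: (igood_no0000 _ (m + c).+3 gu) => //.
  by rewrite (E m.+3) //; lia.
have [v0|v0] := boolP (u (m + c).+1).
  apply: (igood_no1001 _ (m + c + c.+3).+1 gu).
  - by rewrite (E (m + c).+1) //; lia.
  - by rewrite (E (m + c).+2) //; lia.
  - by rewrite (E (m + c).+3) //; lia.
  - by rewrite (_ : _.+4 = (m + c.+3.*2).+1) //; lia.
exact: (igood_no0000 _ (m + c).+1 gu).
Qed.

Lemma notin1_nth (x : word) (k : nat) : `1 \notin x -> ~~ nth `0 x k.
Proof.
move=> x1; apply/negP => xk; move: x1; rewrite -{1}xk mem_nth //.
by case: ltnP xk => // ?; rewrite nth_default.
Qed.

Lemma igood_idelta (u : iword) : igood u -> igood (idelta u).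
Proof.
move=> gu; set v := idelta u; have [_ _ g3 g4] := gu; split.
- case=> i /iprefixP H; have := H 0 isT; have := H 1 isT.
  by rewrite /v !ideltaE addn0 addn1 /=; case: (odd i).
- case=> i /iprefixP H; have := H 0 isT; have := H 3 isT.
  by rewrite /v !ideltaE addn0 addn3 /=; case: (odd i).
- case=> g [ng [i]]; rewrite -/(ishift i v) => H.
  have := H; rewrite /morph /= cats0 => /iprefix_cat [].
  rewrite ishift_ishift => x0 /iprefix_cat [x1 /iprefix_cat [_ _]].
  (* If g(0) contains a 1, its adjacent copies force an even length and the occurrence can be
     halved; otherwise the occurrence consists of at least four zeros. *)
  have [x|x] := boolP (`1 \in g `0).
    apply: g3; apply: (iencounters_half _ _ _ _ ng _ H) => a.
    rewrite !inE !orbb => /eqP ->.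
    by have := odd_occurrences _ _ _ _ x x0 x1; rewrite oddD; case: (odd i); case: (odd _).
  have Z j : j < 4 -> ~~ v (i + j).
    move=> j4; move/iprefixP: H => /(_ j); rewrite /ishift => ->.
      by apply: notin1_nth; rewrite /morph /= cats0 !mem_cat !orbb.
    by rewrite /morph /= !size_cat; have := ng `0; case: (g `0) => //= *; lia.
  apply: (idelta_no0000 _ i gu).
  + by rewrite -[i]addn0 Z.
  + by rewrite -addn1 Z.
  + by rewrite -addn2 Z.
  + by rewrite -addn3 Z.
case=> g [ng [i]]; rewrite -/(ishift i v) => H.
have := H; rewrite /morph /= cats0.
set x := g `0; set y := g `1; set a := size x; set b := size y.
have a0 : 0 < a by rewrite /a /x; have := ng `0; case: (g `0).
have b0 : 0 < b by rewrite /b /y; have := ng `1; case: (g `1).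
case/iprefix_cat => x0; rewrite ishift_ishift -/a.
case/iprefix_cat => x1; rewrite ishift_ishift -/a.
case/iprefix_cat => x2; rewrite ishift_ishift -/a.
case/iprefix_cat => y0; rewrite ishift_ishift -/b.
case/iprefix_cat => x3; rewrite ishift_ishift -/a.
case/iprefix_cat => y1; rewrite ishift_ishift -/b.
case/iprefix_cat => x4; rewrite ishift_ishift -/a => x5.
(* If x contains a 1, the copies at distance a make a even and those at distance a + b make b even,
   so halving applies. Otherwise x consists of zeros. *)
have [x1x|x1x] := boolP (`1 \in x).
  have := odd_occurrences _ _ _ _ x1x x0 x1; have := odd_occurrences _ _ _ _ x1x x2 x3.
  rewrite !oddD => p1 p2; apply: g4; apply: (iencounters_half _ _ _ _ ng _ H) => -[] _.
    by move: p1 p2; rewrite -/y -/b; case: (odd i); case: (odd a); case: (odd b).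
  by move: p2; rewrite -/x -/a; case: (odd i); case: (odd a).
have Zx k j : iprefix x (ishift k v) -> j < a -> ~~ v (k + j).
  by move=> /iprefixP Hx ja; have := Hx _ ja; rewrite /ishift => ->; apply: notin1_nth.
have Z j : j < 3 * a -> ~~ v (i + j).
  move=> j3; have [ja|ja] := ltnP j a; first exact: Zx.
  have [ja2|ja2] := ltnP j (a + a).
    by rewrite (_ : i + j = i + a + (j - a)); [apply: Zx => //; lia|lia].
  by rewrite (_ : i + j = i + a + a + (j - a - a)); [apply: Zx => //; lia|lia].
have Z0 := Z 0; have Z1 := Z 1; have Z2 := Z 2.
rewrite addn0 in Z0; rewrite addn1 in Z1; rewrite addn2 in Z2.
(* Since 0000 does not occur in v, the prefix xxx is exactly 000 and y begins with 1. Hence i is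
   even, and the two copies of y, at distance b + 1, make b odd. *)
have Z4 : v i.+3.
  by apply/negP => /negP; apply: (idelta_no0000 _ i gu); first [apply: Z0|apply: Z1|apply: Z2]; lia.
have a1 : a = 1.
  have [|] := ltnP 1 a; last by lia.
  by move=> a1; have := Z 3; rewrite addn3 Z4 /= => H3; have : false by apply: H3; lia.
rewrite !a1 !addn1 in Z0 Z1 Z2 x0 x1 x2 x3 x4 x5 y0 y1.
have {Z0 Z1 Z2} [Z0 Z1 Z2] : [/\ ~~ v i, ~~ v i.+1 & ~~ v i.+2] by rewrite Z0 ?Z1 ?Z2.
have oi : odd i = false by move: Z4; rewrite /v ideltaE /= negbK; case: (odd i).
have ob : odd b.
  have y1y : `1 \in y.
    move/iprefixP: y0 => /(_ 0 b0); rewrite /ishift addn0 Z4 => ->; exact: mem_nth.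
  by have := odd_occurrences _ _ _ _ y1y y0 y1; rewrite /= oddD /= oi; case: (odd b).
have vE k l : l = k.*2.+1 -> v l = ~~ u k.
  by move=> ->; rewrite /v ideltaE /= odd_double /= uphalf_double.
have iE : i = i./2.*2 by lia.
(* The odd positions of v, from the second 0 to the last 0 of the occurrence, spell 1YY1 in u after
   negation, where Y is read off y and has length (b + 1)/2. *)
apply: (@igood_no1YY1 u i./2 (uphalf b) gu); first by lia.
- by move: Z1; rewrite (vE i./2) ?negbK //; lia.
- have := Zx _ 0 x5; rewrite a1 addn0 (vE (i./2 + (uphalf b).*2).+1) ?negbK; last by lia.
  exact.
- move=> j jb; apply: negb_inj; rewrite -(vE _ (i.+3 + j.*2)); last by lia.
  rewrite -(vE _ ((i.+3 + b).+1 + j.*2)); last by lia.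
  move/iprefixP: y0 => /(_ j.*2); rewrite /ishift => ->; last by rewrite -/b; lia.
  by move/iprefixP: y1 => /(_ j.*2); rewrite /ishift => -> //; rewrite -/b; lia.
Qed.

(** The forbidden factors turn into the forbidden patterns themselves: delta(11) = 0000 and
    delta(1001) = 00010100. *)
Lemma idelta_igood (u : iword) : igood (idelta u) -> igood u.
Proof.
move=> gu; have [_ _ g3 g4] := gu; split.
- case=> i /iprefix_idelta; rewrite -/(ishift i u) -ishift_idelta => H.
  by apply: g3; exists (fun=> [:: `0]); split=> //; exists i.*2.
- case=> i /iprefix_idelta; rewrite -/(ishift i u) -ishift_idelta => H.
  by apply: g4; exists (fun a => [:: a]); split=> //; exists i.*2.
- by move/iencounters_idelta.
- by move/iencounters_idelta.
Qed.

(** A first 1 at an even position from 4 on would follow two zeros; the letter before these gives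
    1001 if it is 1, and otherwise 0000 occurs. Looking back four letters is why positions 0 and 2
    are both assumed. *)
Lemma desubstitution (v : iword) : igood v -> ~~ v 0 -> ~~ v 2 ->
  v = idelta (fun m => ~~ v m.*2.+1).
Proof.
move=> gv v0 v2.
have ev m : ~~ v m.*2.
  elim/ltn_ind: m => -[|[|m]] // IH; apply/negP => vm.
  rewrite !doubleS in vm; have v3 : ~~ v m.*2.+3.
    by apply/negP => H; exact: (igood_no11 _ _ gv H vm).
  have v2' : ~~ v m.*2.+2 by rewrite -doubleS IH.
  have [v1|v1] := boolP (v m.*2.+1); first exact: (igood_no1001 _ _ gv v1 v2' v3 vm).
  by apply: (igood_no0000 _ m.*2 gv); rewrite ?IH.
apply/funext => i; rewrite ideltaE negbK -[in LHS](odd_double_half i).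
by case: (odd i) => //=; rewrite add0n; apply/negbTE.
Qed.

(** * Extending a good word to the left by one letter *)

Lemma igood_icat1 (a : bool) (u : iword) : igood u -> ~ (a /\ u 0) ->
  ~ [/\ a, ~~ u 0, ~~ u 1 & u 2] ->
  (forall g, nonerasing g ->
    ~ iprefix (morph g [:: `0; `0; `0; `0]) (icat [:: a] u)) ->
  (forall g, nonerasing g ->
    ~ iprefix (morph g [:: `0; `0; `0; `1; `0; `1; `0; `0]) (icat [:: a] u)) ->
  igood (icat [:: a] u).
Proof.
move=> [g1 g2 g3 g4] n11 n1001 h3 h4.
have tailE i : ishift i.+1 (icat [:: a] u) = ishift i u.
  by rewrite -[i.+1]add1n -ishift_ishift (ishift_icat [:: a]).
split.
- case=> -[|i]; rewrite -/(ishift _ _); last by rewrite tailE => H; apply: g1; exists i.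
  by move/iprefixP => H; apply: n11; have := H 0 isT; have := H 1 isT.
- case=> -[|i]; rewrite -/(ishift _ _); last by rewrite tailE => H; apply: g2; exists i.
  move/iprefixP => H; apply: n1001; have := H 0 isT; have := H 1 isT.
  by have := H 2 isT; have := H 3 isT; rewrite /ishift /icat /= => -> -> -> ->.
- case=> g [ng [[|i]]]; rewrite -/(ishift _ _) ?tailE; first exact: h3.
  by move=> H; apply: g3; exists g; split=> //; exists i.
- case=> g [ng [[|i]]]; rewrite -/(ishift _ _) ?tailE; first exact: h4.
  by move=> H; apply: g4; exists g; split=> //; exists i.
Qed.

Lemma igood_icat1_conj (a : bool) (u : iword) : igood u -> ~ (a /\ u 0) ->
  ~ [/\ a, ~~ u 0, ~~ u 1 & u 2] ->
  igood (ishift 1 (idelta (icat [:: a] u))) -> igood (icat [:: a] u).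
Proof.
move=> gu n11 n1001 [_ _ h3 h4].
apply: igood_icat1 => // g ng /(iencounters_conj _ _ _ ng).
  exact: h3.
exact: h4.
Qed.

(** Here y = 1 delta(u), hence 0y = delta(0u). A pattern at the start of 0u would, by conjugation,
    already be encountered by y. *)
Lemma igood_icat0 (y : iword) : igood y -> y 0 -> igood (icat [:: `0] y).
Proof.
move=> gy y0.
have y1 : ~~ y 1 by apply/negP; exact: igood_no11.
have y3 : ~~ y 3.
  apply/negP => y3; apply: (igood_no1001 _ 0 gy) => //; apply/negP => y2.
  exact: (igood_no11 _ 2 gy).
have /desubstitution := igood_ishift 1 _ gy; rewrite /ishift => /(_ y1 y3).
rewrite -/(ishift 1 y); set u := (X in idelta X) => yE.
have yE' : icat [:: `0] y = idelta (icat [:: `0] u).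
  rewrite idelta_icat -yE (_ : delta [:: `0] = [:: `0] ++ [:: `1]) // icat_cat.
  by rewrite -{1}[y](icat_ishift [:: `1]) //; apply/iprefixP => -[].
rewrite yE'; apply: igood_idelta; apply: igood_icat1_conj.
- by apply: idelta_igood; rewrite -yE; apply: igood_ishift.
- by case.
- by case.
- by rewrite -yE' (ishift_icat [:: `0]).
Qed.

(* A cube at the start of 0 delta(u) would have an even period 2k with k > 1; its
   second block copies 0010100, forcing 1001 at position k - 1 of u. *)
Lemma no_cube_prefix (u : iword) (x : word) : igood u ->
  ~~ u 0 -> ~~ u 1 -> u 2 -> 0 < size x ->
  ~ iprefix (x ++ x ++ x) (icat [:: `0] (idelta u)).
Proof.
move=> gu u0 u1 u2 x0 H.
have {H} E j : j < (size x).*2 ->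
    icat [:: `0] (idelta u) (j + size x) = icat [:: `0] (idelta u) j.
  move/iprefixP: H => H jx; rewrite !H ?size_cat; try lia.
  rewrite nth_cat ifF ?addnK; last by lia.
  by rewrite [in RHS]catA [in RHS]nth_cat ifT ?size_cat //; lia.
set v := icat _ _ in E.
have vE k l : l = k.*2.+2 -> v l = ~~ u k.
  by move=> ->; rewrite /v /icat /= subn1 ideltaE /= odd_double uphalf_double.
have vO k : v k.*2.+1 = false.
  by rewrite /v /icat /= subn1 ideltaE /= odd_double.
have v2 : v 2 by rewrite (vE 0).
have := odd_double_half (size x); case: (odd (size x)); case: (size x)./2 => [|k] aE.
- by have := E 1; rewrite -aE /= v2 (vO 0) => /(_ isT).
- by have := E 2; rewrite v2 (_ : 2 + size x = k.+2.*2.+1) ?vO => [H|]; [suff: false by []; apply: H|]; lia.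
- by move: x0; rewrite -aE.
case: k => [|k] in aE *.
  by have := E 0; rewrite -aE /= v2 => /(_ isT).
apply: (igood_no1001 _ k.+1 gu).
- apply/negbNE; rewrite -(vE k.+1 (0 + size x)); last by lia.
  by rewrite E //; lia.
- rewrite -(vE k.+2 (2 + size x)); last by lia.
  by rewrite E ?v2 //; lia.
- rewrite -(vE k.+3 (4 + size x)); last by lia.
  by rewrite E ?(vE 1) ?u1 //; lia.
- apply/negbNE; rewrite -(vE k.+4 (6 + size x)); last by lia.
  by rewrite E ?(vE 2) ?u2 //; lia.
Qed.

Lemma igood_icat0_idelta (u : iword) :
  igood u -> ~~ u 0 -> ~~ u 1 -> u 2 -> igood (icat [:: `0] (idelta u)).
Proof.
move=> gu u0 u1 u2; have nc x := no_cube_prefix u x gu u0 u1 u2.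
apply: igood_icat1; [exact: igood_idelta|by case|by case| |] => g ng.
- rewrite /morph /= !catA -catA => /iprefix_cat [H _].
  by apply: (nc (g `0)); rewrite 1?catA //; have := ng `0; case: (g `0).
- rewrite /morph /= !catA -5!catA => /iprefix_cat [H _].
  by apply: (nc (g `0)); rewrite 1?catA //; have := ng `0; case: (g `0).
Qed.

Lemma Gp1E : Gp [:: `1] = icat [:: `0] @^-1` Gp [:: `0; `1].
Proof.
apply/seteqP; split=> y /=.
  move=> /GpE [gy /iprefixP /(_ 0 isT) /= y0].
  apply/GpE; split; first exact: igood_icat0.
  by apply/iprefixP => -[|[|]].
move=> /GpE [/(igood_ishift 1)]; rewrite (ishift_icat [:: `0]) => gy.
move=> /iprefixP /(_ 1 isT) /= y0; apply/GpE; split=> //.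
by apply/iprefixP => -[].
Qed.

Lemma Gp0001E : Gp [:: `0; `0; `0; `1] = idelta @` Gp [:: `1].
Proof.
apply/seteqP; split=> y /=.
  move=> /GpE [gy /iprefixP yE].
  have uE := desubstitution y gy; rewrite (yE 0) // (yE 2) // in uE.
  have {uE} := uE isT isT; set u := (X in idelta X) => uE.
  exists u; last by [].
  apply/GpE; split; first by apply: idelta_igood; rewrite -uE.
  by apply/iprefixP => -[|//] _; rewrite /u (yE 1).
case=> u /GpE [gu /iprefixP /(_ 0 isT) /= u0] <-.
have u1 : ~~ u 1 by apply/negP; exact: igood_no11.
apply/GpE; split; first exact: igood_idelta.
by apply/iprefixP => -[|[|[|[|//]]]] _; rewrite ideltaE //= ?u0 ?u1.
Qed.

Lemma Gp001E : Gp [:: `0; `0; `1] =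
  icat [:: `0] @` (idelta @`
    ((icat [:: `0; `1] @^-1` Gp [:: `0; `1]) `|` Gp [:: `0; `0; `1])).
Proof.
have e01 u : icat [:: `0; `1] u = icat [:: `0] (icat [:: `1] u) by rewrite -icat_cat.
apply/seteqP; split=> y /=.
  move=> /GpE [gy /iprefixP yE].
  have y0E : icat [:: `0] (ishift 1 y) = y.
    by apply: (icat_ishift [:: `0]); apply/iprefixP => -[|//] _; rewrite yE.
  have gv := igood_ishift 1 _ gy.
  have y3 : ~~ y 3 by apply/negP; apply: (igood_no11 _ 2 gy); rewrite yE.
  have := desubstitution _ gv; rewrite {1 2}/ishift (yE 1) // => /(_ isT y3).
  set u := (X in idelta X) => vE.
  have gu : igood u by apply: idelta_igood; rewrite -vE.
  have u0 : ~~ u 0 by rewrite /u /ishift (yE 2).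
  exists (ishift 1 y) => //; exists u => //.
  have [u12|n12] := boolP (~~ u 1 && u 2).
    right; apply/GpE; split=> //; case/andP: u12 => /negbTE u1 u2.
    by apply/iprefixP => -[|[|[|//]]] _; rewrite ?u1 ?u2 // (negbTE u0).
  left; apply/GpE; split; last first.
    by apply/iprefixP => -[|[|]].
  rewrite e01; apply: igood_icat0 => //; apply: igood_icat1_conj => //.
  - by case=> _; apply/negP.
  - by case=> _ _ u1 u2; rewrite u1 u2 in n12.
  rewrite idelta_icat -vE (_ : delta [:: `1] = [:: `0] ++ [:: `0]) // icat_cat.
  by rewrite y0E (ishift_icat [:: `0]).
case=> _ [u Hu <-] <-.
have : igood (icat [:: `0] (idelta u)) /\ ~~ u 0.
  case: Hu => /GpE [].
    rewrite e01 => /(igood_ishift 1); rewrite (ishift_icat [:: `0]) => g1u _.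
    have u0 : ~~ u 0 by apply/negP; apply: (igood_no11 _ 0 g1u).
    split=> //; have /(igood_ishift 1) := igood_idelta _ g1u.
    by rewrite idelta_icat (_ : delta [:: `1] = [:: `0] ++ [:: `0]) // icat_cat.
  move=> gu /iprefixP uE; split; last by rewrite uE.
  by apply: igood_icat0_idelta => //; rewrite uE.
case=> g0u u0; apply/GpE; split=> //.
by apply/iprefixP => -[|[|[|//]]] _ //=; rewrite /icat /= ideltaE /= ?subSS ?subn0 ?subnn /= ?u0.
Qed.

Lemma size_iter_delta (n : nat) (x : word) :
  size (iter n delta x) = 2 ^ n * size x.
Proof. by elim: n => [|n IH]; rewrite ?mul1n // iterS size_delta IH expnS; lia. Qed.

Lemma iter_delta_cat (n : nat) (x y : word) :
  iter n delta (x ++ y) = iter n delta x ++ iter n delta y.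
Proof. by elim: n => // n IH; rewrite !iterS IH delta_cat. Qed.

Lemma delta_inj : injective delta.
Proof.
move=> x y xy; have sxy : size x = size y.
  by have := congr1 size xy; rewrite !size_delta; lia.
apply: (eq_from_nth (x0 := `1)) => // i _.
have := congr1 (nth `0 ^~ i.*2.+1) xy.
by rewrite /= !nth_delta /= odd_double /= uphalf_double; apply: negb_inj.
Qed.

Lemma iter_idelta_icat (n : nat) (x : word) (u : iword) :
  iter n idelta (icat x u) = icat (iter n delta x) (iter n idelta u).
Proof. by elim: n => // n IH; rewrite !iterS IH idelta_icat. Qed.

(* delta^n(00) and delta^n(01) differ, which excludes level n + 1; delta^k(01) with
   k > n + 1 is too long. *)
Lemma level_eq (n : nat) (y : word) : size y + 4 <= 2 ^ n.+2 ->
  level (y ++ iter n delta [:: `0; `1]) = n.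
Proof.
move=> yn; set w := y ++ _.
have sw : size w = size y + 2 ^ n * 2 by rewrite size_cat size_iter_delta.
have n2 : n < 2 ^ n by apply: ltn_expl.
apply/eqP; rewrite eqn_leq; apply/andP; split.
  apply/bigmax_leqP => -[k /= kw] sk; rewrite leqNgt; apply/negP => nk.
  have [kn|kn] : k = n.+1 \/ n.+2 <= k by lia.
    move: sk; rewrite kn iterSr (_ : delta _ = [:: `0; `1; `0] ++ [:: `0]) //.
    rewrite iter_delta_cat => /suffixP [z].
    rewrite /w (iter_delta_cat n [:: `0] [:: `1]) !catA.
    set a := y ++ _; set b := z ++ _ => ab.
    have sab : size a = size b.
      by have := congr1 size ab; rewrite !size_cat !size_iter_delta /=; lia.
    have := congr1 (drop (size a)) ab; rewrite drop_size_cat // sab drop_size_cat //.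
    elim: n {yn w sw n2 kw nk kn a b ab sab} => // n IH; rewrite !iterS => /delta_inj.
    exact: IH.
  have := size_suffix sk; rewrite size_iter_delta sw.
  have : 2 ^ n.+2 <= 2 ^ k by rewrite leq_exp2l.
  by move: yn; rewrite !expnS /=; lia.
have nw : n < size w by rewrite sw; lia.
apply: (@leq_bigmax_cond _ _ (fun k : 'I_(size w) => k : nat) (Ordinal nw)).
exact: suffix_suffix.
Qed.

Definition oper_zeros (o : oper) : nat :=
  match o with Alpha => 0 | Beta => 1 | Gamma => 2 end.

Lemma oper_wordE (o : oper) :
  [:: `0; `1] ++ oper_word o = delta (nseq (oper_zeros o) `0 ++ [:: `0; `1]).
Proof. by case: o. Qed.

Lemma apply_operE (o : oper) (n : nat) (y : word) : size y + 4 <= 2 ^ n.+2 ->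
  apply_oper o (y ++ iter n delta [:: `0; `1]) =
  (y ++ iter n.+1 delta (nseq (oper_zeros o) `0)) ++ iter n.+1 delta [:: `0; `1].
Proof.
move=> yn; rewrite /apply_oper level_eq // -!catA; congr (y ++ _).
by rewrite -!iter_delta_cat oper_wordE iterSr.
Qed.

Lemma Gp01_step (v : iword) : Gp [:: `0; `1] v -> exists o v',
  Gp [:: `0; `1] v' /\ v = idelta (icat (nseq (oper_zeros o) `0) v').
Proof.
case/GpE => gv /iprefixP vE.
have v2 : ~~ v 2 by apply/negP; apply: (igood_no11 _ 1 gv); rewrite vE.
have := desubstitution v gv; rewrite {1}vE // => /(_ isT v2).
set t := (X in idelta X) => tE.
have gt : igood t by apply: idelta_igood; rewrite -tE.
have t0 : t 0 = `0 by rewrite /t vE.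
have take_zeros o : iprefix (nseq (oper_zeros o) `0 ++ [:: `0; `1]) t ->
    exists o v', Gp [:: `0; `1] v' /\ v = idelta (icat (nseq (oper_zeros o) `0) v').
  case/iprefix_cat => zt; rewrite size_nseq => t01; exists o, (ishift (oper_zeros o) t).
  split; first by apply/GpE; split=> //; apply: igood_ishift.
  by rewrite tE -{1}(icat_ishift _ _ zt) size_nseq.
have [t1|t1] := boolP (t 1).
  by apply: (take_zeros Alpha); apply/iprefixP => -[|[|]].
have [t2|t2] := boolP (t 2).
  by apply: (take_zeros Beta); apply/iprefixP => -[|[|[|]]] //= _; apply/negbTE.
have [t3|t3] := boolP (t 3).
  by apply: (take_zeros Gamma); apply/iprefixP => -[|[|[|[|]]]] //= _; apply/negbTE.
by case: (igood_no0000 t 0 gt); rewrite ?t0.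
Qed.

Lemma apply_opers_prefix (f : nat -> oper) (v : nat -> iword) :
  (forall n, v n = idelta (icat (nseq (oper_zeros (f n)) `0) (v n.+1))) ->
  forall n, exists2 y : word, size y + 4 <= 2 ^ n.+2 &
    apply_opers [:: `0; `1] f n = y ++ iter n delta [:: `0; `1] /\
    v 0 = icat y (iter n idelta (v n)).
Proof.
move=> vE; elim=> [|n [y yn [opE v0E]]].
  by exists [::] => //; split=> //; apply/funext => i; rewrite /icat subn0.
exists (y ++ iter n.+1 delta (nseq (oper_zeros (f n)) `0)).
  have : oper_zeros (f n) <= 2 by case: (f n).
  rewrite size_cat size_iter_delta size_nseq; move: yn; rewrite !expnS.
  by case: (oper_zeros _) => [|[|[|]]] //; lia.
split; first by rewrite /= opE apply_operE.
by rewrite v0E vE -iterSr iter_idelta_icat icat_cat.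
Qed.

Lemma Gp01_bullet (u : iword) : Gp [:: `0; `1] u -> exists f, bullet [:: `0; `1] f = u.
Proof.
move=> Gu.
have /choice [s sP] (v : {v | Gp [:: `0; `1] v}) : exists ov : oper * {v | Gp [:: `0; `1] v},
    sval v = idelta (icat (nseq (oper_zeros ov.1) `0) (sval ov.2)).
  have [o [v' [Gv' vE]]] := Gp01_step _ (svalP v).
  by exists (o, exist _ v' Gv').
pose x n := iter n (fun v => (s v).2) (exist _ u Gu).
pose f n := (s (x n)).1.
exists f; apply/funext => i; rewrite /bullet.
have [|y _ [-> u0E]] := @apply_opers_prefix f (fun n => sval (x n)) _ i.+1.
  by move=> n; exact: sP.
have [_ /iprefixP x01] := (GpE _ _).1 (svalP (x i.+1)).
have : iprefix (y ++ iter i.+1 delta [:: `0; `1]) u.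
  rewrite (_ : u = sval (x 0)) // u0E -(icat_ishift [:: `0; `1] (sval (x i.+1))); last exact/iprefixP.
  rewrite iter_idelta_icat -icat_cat; exact: iprefix_icat.
move/iprefixP => -> //; rewrite size_cat size_iter_delta.
by have := ltn_expl i.+1 (ltnSn 1); move=> /=; lia.
Qed.

Lemma iprefix_bullet (f : nat -> oper) : iprefix [:: `0; `1] (bullet [:: `0; `1] f).
Proof.
apply/iprefixP => j j2; rewrite /bullet.
have [r ->] : exists r, apply_opers [:: `0; `1] f j.+1 = [:: `0; `1] ++ r.
  elim: j.+1 => [|n [r E]]; first by exists [::].
  by eexists; rewrite [LHS]/= /apply_oper {1}E -catA.
by rewrite nth_cat j2.
Qed.

Theorem theorem3p7 :
  [/\ Gp [:: `0; `1] = bullet [:: `0; `1] @` W,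
      Gp [:: `0; `0; `1] =
        icat [:: `0] @`
          (idelta @`
             ((icat [:: `0; `1] @^-1` Gp [:: `0; `1]) `|` Gp [:: `0; `0; `1])),
      Gp [:: `0; `0; `0; `1] = idelta @` Gp [:: `1]
    & Gp [:: `1] = icat [:: `0] @^-1` Gp [:: `0; `1]].
Proof.
split; [|exact: Gp001E|exact: Gp0001E|exact: Gp1E].
apply/seteqP; split=> u.
  move=> Gu; have [f fE] := Gp01_bullet u Gu.
  by exists f => //; rewrite /W /= fE; case: Gu.
by case=> f Wf <-; apply/GpE; split=> //; exact: iprefix_bullet.
Qed.
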